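(* Let $\mathbb{D}$ be the open unit disk in $\mathbb{C}$ and let $\mathcal{O}(\mathbb{D})$ be the space of holomorphic functions on $\mathbb{D}$ with the topology of uniform convergence on compact subsets. For $B\subset\mathbb{N}$ put $f_B(z)=\sum_{n=0}^\infty \mathbbm{1}_B(n)z^n$. There exists a compact set $\mathfrak{S}\subset\mathcal{O}(\mathbb{D})$ such that, for every $S\subset\mathbb{N}$, $S$ is a Sidon set contained in $\mathbb{N}^*$ if and only if $f_S\in\mathfrak{S}$. Moreover, for every continuous function $f$ on $[0,1[$ such that $\int_0^1 \frac{|f(t)|\sqrt{t}}{\sqrt{1-t}}\,dt<+\infty$, the quantity $$\sup_{g\in\mathfrak{S}}\int_0^1 g(t)|f(t)|\,dt$$ is finite and is attained by some $g_0\in\mathfrak{S}$.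
   Context: A Sidon set is a set $S$ of positive integers such that all the sums $s+s'$ with $s,s'\in S$, $s\le s'$, are distinct. $\mathbb{N}=\{0,1,2,\dots\}$ and $\mathbb{N}^*=\{1,2,\dots\}$. *)

(* Defs.v *)
From HB Require Import structures.
From mathcomp Require Import all_boot all_order all_algebra.
From mathcomp Require Import all_classical all_reals all_analysis.
From mathcomp Require Import complex.
Import numFieldNormedType.Exports.

Set Implicit Arguments.
Unset Strict Implicit.
Unset Printing Implicit Defensive.

Import Order.TTheory GRing.Theory Num.Theory.

Local Open Scope classical_set_scope.
Local Open Scope ring_scope.
Local Open Scope complex_scope.

(* The library puts a topology on a numFieldType K and on K^o; instance search
   on R[i] only finds the latter, so it is copied, together with the module
   structure of R[i] over itself. *)
HB.instance Definition _ (R : rcfType) := PseudoPointedMetric.copy R[i] R[i]^o.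
HB.instance Definition _ (R : rcfType) := GRing.ComAlgebra.copy R[i] R[i]^o.
HB.instance Definition _ (R : rcfType) := Vector.copy R[i] R[i]^o.
HB.instance Definition _ (R : rcfType) := NormedModule.copy R[i] R[i]^o.

Definition sidon (S : set nat) : Prop :=
  (forall s, S s -> (0 < s)%N) /\
  (forall a b c d, S a -> S b -> S c -> S d ->
     (a <= b)%N -> (c <= d)%N -> (a + b = c + d)%N -> a = c /\ b = d).

Definition unit_disk (R : realType) : set R[i] := [set z | `|z| < 1].
Arguments unit_disk : clear implicits.

(* A function on the disk is represented by the total function extending it by
   0 outside the disk. The representation being unique, two elements of
   [hol_disk R] are equal iff they agree on the disk, and [compactly_in] gives
   [hol_disk R] its topology of uniform convergence on compact subsets of the
   disk. Differentiability is over the field R[i], i.e. complex. *)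
Definition hol_disk (R : realType) :
    set {family compactly_in (unit_disk R), R[i] -> R[i]} :=
  [set g : R[i] -> R[i] |
    (forall z, unit_disk R z -> derivable g z 1) /\
    (forall z, ~ unit_disk R z -> g z = 0)].
Arguments hol_disk : clear implicits.

Definition genfun (R : realType) (B : set nat) (z : R[i]) : R[i] :=
  if `|z| < 1 then limn (series (fun n => \1_B n * z ^+ n)) else 0.
Arguments genfun : clear implicits.

(* Main.v *)
Require Import Defs.
From mathcomp Require Import all_boot all_order all_algebra.
From mathcomp Require Import all_classical all_reals all_analysis.
From mathcomp Require Import complex.
From mathcomp Require Import measurable_realfun ring lra.
Import Order.TTheory GRing.Theory Num.Theory.
Import numFieldNormedType.Exports.
Import ComplexField.Normc.

(* The compact set is the family of all f_S with S a Sidon set. Being Sidon is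
   decided on finite windows, so Sidon sets form a closed subset of the Cantor
   space, and S |-> f_S is continuous because sets agreeing below N have
   generating functions differing by O(r^N) on |z| <= r. Each integer has at
   most two ordered representations as a sum of two elements of S, so
   f_S(t)^2 <= 2 t / (1 - t) on [0, 1[. The integral therefore converges, and by
   dominated convergence the tails are small uniformly in S: the functional is
   continuous on a compact set and attains its maximum. *)

Local Open Scope classical_set_scope.
Local Open Scope ring_scope.
Local Open Scope complex_scope.

Set Implicit Arguments.
Unset Strict Implicit.
Unset Printing Implicit Defensive.

(* Otherwise [/=] unfolds the modulus into a square root of squares. *)
#[local] Arguments normc : simpl never.

(** * Modulus of complex numbers *)

Lemma norm_normc (R : realType) (z : R[i]) : `|z| = (normc z)%:C.
Proof. by []. Qed.

Lemma normc_ge0 (R : realType) (z : R[i]) : 0 <= normc z.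
Proof. by case: z => x y; exact: sqrtr_ge0. Qed.

Lemma normcD (R : realType) (x y : R[i]) : normc (x + y) <= normc x + normc y.
Proof. exact: (@le_normcD R x y). Qed.

Lemma normc_opp (R : realType) (x : R[i]) : normc (- x) = normc x.
Proof. exact: (@normcN R x). Qed.

Lemma normc_sub (R : realType) (x y : R[i]) : normc (x - y) = normc (y - x).
Proof. by rewrite -normc_opp opprB. Qed.

Lemma normcX (R : realType) (x : R[i]) n : normc (x ^+ n) = normc x ^+ n.
Proof. by elim: n => [|n IH]; rewrite ?expr0 ?normc1 // !exprS normcM IH. Qed.

Lemma normcR (R : realType) (x : R) : normc x%:C = `|x|.
Proof. by rewrite /normc /= expr0n /= addr0 sqrtr_sqr. Qed.

Lemma unit_diskE (R : realType) (z : R[i]) : (`|z| < 1) = (normc z < 1).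
Proof. by rewrite norm_normc -(ltcR (normc z) 1). Qed.

Lemma normc_sum (R : realType) (I : Type) (s : seq I) (P : pred I) (F : I -> R[i]) :
  normc (\sum_(i <- s | P i) F i) <= \sum_(i <- s | P i) normc (F i).
Proof.
elim/big_rec2: _ => [|i x y _ h]; first by rewrite normc0.
exact: le_trans (normcD _ _) (lerD _ h).
Qed.

Lemma normc_le_ReIm (R : realType) (z : R[i]) :
  normc z <= `|complex.Re z| + `|complex.Im z|.
Proof.
rewrite [z in normc z]complexE; apply: le_trans (normcD _ _) _.
rewrite normcM !normcR; have -> : normc ('i%C : R[i]) = 1.
  by rewrite /normc /= expr0n add0r expr1n sqrtr1.
by rewrite mul1r.
Qed.

Lemma Re_le_normc (R : realType) (z : R[i]) : `|complex.Re z| <= normc z.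
Proof. by have := normc_ge_Re z; rewrite norm_normc lecR. Qed.

Lemma Im_le_normc (R : realType) (z : R[i]) : `|complex.Im z| <= normc z.
Proof.
case: z => x y; rewrite /normc /= -sqrtr_sqr.
by rewrite ler_sqrt ?lerDr ?addr_ge0 ?sqr_ge0.
Qed.

(** The order on [R[i]] only compares numbers with equal imaginary parts. This lets every epsilon of
    the [R[i]]-valued norm be taken in [R]. *)
Lemma gt0_complexE (R : realType) (e : R[i]) : 0 < e ->
  exists2 d : R, 0 < d & e = d%:C.
Proof. by case: e => x y; rewrite ltcE /= => /andP[/eqP -> x0]; exists x. Qed.

Lemma cvg_normc (R : realType) (T : Type) (F : set_system T) {FF : Filter F}
    (u : T -> R[i]) (l : R[i]) :
  (forall e : R, 0 < e -> \forall t \near F, normc (l - u t) < e) -> u @ F --> l.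
Proof.
move=> h; apply/cvgrPdist_lt => e /gt0_complexE[d d0 ->].
near=> t; rewrite norm_normc ltcR; near: t; exact: h.
Unshelve. all: by end_near. Qed.

Lemma near_normc (R : realType) (z : R[i]) (e : R) : 0 < e ->
  \forall w \near z, normc (z - w) < e.
Proof.
move=> e0; have ec : 0 < e%:C by rewrite ltcR.
have := @cvg_id _ (nbhs z) => /cvgrPdist_lt /(_ _ ec).
by apply: filterS => w; rewrite norm_normc ltcR.
Qed.

Lemma near_normc_lt1 (R : realType) (z : R[i]) : normc z < 1 ->
  \forall w \near z, normc w < 1.
Proof.
move=> z1; near=> w; rewrite -(subrK z w).
apply: le_lt_trans (normcD _ _) _; rewrite -ltrBrDr normc_sub.
by near: w; apply: near_normc; rewrite subr_gt0.
Unshelve. all: by end_near. Qed.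

Lemma sum_geometric_le (R : realType) (r : R) (m n : nat) : 0 <= r < 1 ->
  \sum_(m <= k < n) r ^+ k <= r ^+ m / (1 - r).
Proof.
move=> /andP[r0 r1]; have d0 : 0 < 1 - r by rewrite subr_gt0.
rewrite ler_pdivlMr //; have [mn|/ltnW nm] := leqP m n; last first.
  by rewrite big_geq // mul0r exprn_ge0.
rewrite big_distrl /= (eq_bigr (fun k => - (r ^+ k.+1 - r ^+ k))); last first.
  by move=> k _; rewrite exprS; ring.
by rewrite sumrN telescope_sumr // opprB lerBlDr lerDl exprn_ge0.
Qed.

(** * Power series with bounded coefficients *)

Lemma near_geometric_lt (R : realType) (c r e : R) : 0 <= c -> 0 <= r < 1 -> 0 < e ->
  \forall n \near \oo, c * r ^+ n < e.
Proof.
move=> c0 /andP[r0 r1] e0.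
have : c * r ^+ n @[n --> \oo] --> c * 0.
  by apply: cvgMl_tmp; apply: cvg_expr; rewrite ger0_norm.
rewrite mulr0 => /cvgrPdist_lt /(_ _ e0); apply: filterS => n.
by rewrite sub0r normrN ger0_norm // mulr_ge0 // exprn_ge0.
Qed.

Definition power_series (R : realType) (a : nat -> R[i]) (z : R[i]) : R[i] :=
  limn (series (fun n => a n * z ^+ n)).

Section power_series.
Variables (R : realType) (a : nat -> R[i]) (M : R).
Hypothesis aM : forall n, normc (a n) <= M.
Variable z : R[i].
Hypothesis z1 : normc z < 1.
Let P n := \sum_(0 <= k < n) a k * z ^+ k.
Let r01 : 0 <= normc z < 1. Proof. by rewrite normc_ge0. Qed.
Let M0 : 0 <= M. Proof. exact: le_trans (normc_ge0 _) (aM 0). Qed.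

(** Convergence is reduced to real series: [p] stands for the real or the imaginary part, both
    linear over [R] and dominated by the modulus, and the image series converges absolutely by
    comparison with the geometric series of ratio |z|. *)
Let cvg_part (p : {linear Rcomplex R -> R}) :
  (forall w : R[i], `|p w| <= normc w) -> cvgn (p \o P).
Proof.
move=> hp; have -> : p \o P = series (fun k => p (a k * z ^+ k)).
  by apply/funext => n; rewrite /P /series /= linear_sum.
apply: normed_cvg; apply: (@series_le_cvg _ _ (geometric M (normc z))) => //.
- by move=> n; exact: normr_ge0.
- by move=> n; rewrite /geometric /= mulr_ge0 // exprn_ge0 // normc_ge0.
- move=> n; rewrite /geometric /=; apply: le_trans (hp _) _.
  by rewrite normcM normcX ler_wpM2r // exprn_ge0 // normc_ge0.
- by apply: is_cvg_geometric_series; rewrite ger0_norm // normc_ge0.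
Qed.

Lemma power_series_cvg : cvgn (series (fun n => a n * z ^+ n)).
Proof.
have hR := @cvg_part (@complex.Re R : Rcomplex R -> R) (@Re_le_normc R).
have hI := @cvg_part (@complex.Im R : Rcomplex R -> R) (@Im_le_normc R).
apply/cvg_ex; exists (limn (@complex.Re R \o P) +i* limn (@complex.Im R \o P)).
apply: cvg_normc => e e0; have e2 : 0 < e / 2 by rewrite divr_gt0.
near=> n; apply: le_lt_trans (normc_le_ReIm _) _; rewrite [e]splitr ltrD //=.
- near: n; have := hR => /cvgrPdist_lt /(_ _ e2); apply: filterS => n.
  by rewrite /P/= /series/= raddfB.
- near: n; have := hI => /cvgrPdist_lt /(_ _ e2); apply: filterS => n.
  by rewrite /P/= /series/= raddfB.
Unshelve. all: by end_near. Qed.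

Lemma power_series_tail N :
  normc (power_series a z - \sum_(0 <= k < N) a k * z ^+ k)
    <= M / (1 - normc z) * normc z ^+ N.
Proof.
set L := power_series _ _; apply/ler_addgt0Pr => e e0.
(* At the cost of e the limit is replaced by a partial sum beyond N, leaving a finite geometric sum
   to bound. *)
have [n [Nn hn]] : exists n, (N <= n)%N /\ normc (L - P n) < e.
  have /cvgrPdist_lt h := power_series_cvg.
  have ec : 0 < e%:C by rewrite ltcR.
  have [n _ hn] := h _ ec.
  exists (maxn N n); rewrite leq_maxl; split => //.
  by have := hn _ (leq_maxr N n); rewrite norm_normc ltcR.
rewrite -(subrK (P n) L) -addrA; apply: le_trans (normcD _ _) _.
rewrite [leRHS]addrC lerD ?(ltW hn) // /P (big_cat_nat (leq0n N) Nn) //= addrAC subrr add0r.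
apply: le_trans (normc_sum _ _ _) _.
apply: (@le_trans _ _ (\sum_(N <= k < n) M * normc z ^+ k)).
  by apply: ler_sum => k _; rewrite normcM normcX ler_wpM2r // exprn_ge0 // normc_ge0.
by rewrite -big_distrr /= mulrAC -mulrA ler_wpM2l // sum_geometric_le.
Qed.

(** Identifies the sum of a series from a geometric error estimate: both candidates are within a
    multiple of |z|^N of the same partial sum. The exponent is one less than the number of terms, as
    in the identity [fP] for difference quotients. *)
Lemma power_series_unique L (B : R) :
  (forall N, normc (L - \sum_(0 <= k < N.+1) a k * z ^+ k) <= B * normc z ^+ N) ->
  power_series a z = L.
Proof.
move=> hL; apply/eqP; rewrite -subr_eq0; apply/eqP; apply: eq0_normc.
apply/le_anti; rewrite normc_ge0 andbT; apply/ler_addgt0Pr => e e0; rewrite add0r.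
have B0 : 0 <= B by have := le_trans (normc_ge0 _) (hL 0%N); rewrite expr0 mulr1.
have c0 : 0 <= M / (1 - normc z) by rewrite divr_ge0 // subr_ge0 ltW.
have [N _ /(_ N (leqnn N)) /ltW hN] := near_geometric_lt (addr_ge0 c0 B0) r01 e0.
apply: le_trans hN; rewrite mulrDl.
rewrite -(subrK (P N.+1) (power_series _ _)) -addrA; apply: le_trans (normcD _ _) _.
apply: lerD; last by rewrite normc_sub; exact: hL.
apply: le_trans (power_series_tail _) _; rewrite ler_wpM2l // exprSr.
by rewrite ler_piMr ?exprn_ge0 ?normc_ge0 ?ltW.
Qed.

Lemma power_series_bound : normc (power_series a z) <= M / (1 - normc z).
Proof. by have := power_series_tail 0; rewrite big_geq // subr0 expr0 mulr1. Qed.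

End power_series.

Lemma power_series_head (R : realType) (a : nat -> R[i]) (M : R) (z : R[i]) :
  (forall n, normc (a n) <= M) -> normc z < 1 ->
  power_series a z = a 0%N + z * power_series (fun n => a n.+1) z.
Proof.
move=> aM z1; have aM1 n : normc (a n.+1) <= M by [].
apply: (power_series_unique aM z1 (B := normc z * (M / (1 - normc z)))) => N.
rewrite big_nat_recl //= expr0 mulr1 opprD addrACA subrr add0r.
rewrite (eq_bigr (fun i => z * (a i.+1 * z ^+ i))); last first.
  by move=> i _; rewrite exprS mulrCA.
rewrite -big_distrr /= -mulrBr normcM -mulrA ler_wpM2l ?normc_ge0 //.
exact: power_series_tail.
Qed.

(* The quotient (f(w) - f(z)) / (w - z) is itself a power series in w, with the
   bounded coefficients b_k = \sum_j a_(k + 1 + j) z^j; this yields continuity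
   and then differentiability without any term-by-term differentiation. *)
Section increment.
Variables (R : realType) (a : nat -> R[i]) (M : R).
Hypothesis aM : forall n, normc (a n) <= M.
Variable z : R[i].
Hypothesis z1 : normc z < 1.

Definition quotient_coef (k : nat) : R[i] := power_series (fun j => a (k + j).+1) z.

Lemma quotient_coef_bound k : normc (quotient_coef k) <= M / (1 - normc z).
Proof. exact: power_series_bound. Qed.

Lemma power_series_increment w : normc w < 1 ->
  power_series a w = power_series a z + (w - z) * power_series quotient_coef w.
Proof.
move=> w1; set b := quotient_coef.
have [M' bM] : exists M', forall k, normc (b k) <= M'.
  by eexists => k; exact: quotient_coef_bound.
have f0 : power_series a z = a 0%N + z * b 0%N by exact: power_series_head aM z1.
have fS k : a k.+1 = b k - z * b k.+1.
  rewrite /b /quotient_coef (@power_series_head _ (fun j => a (k + j).+1) M) //.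
  rewrite addn0 (_ : (fun n => _) = (fun j => a (k.+1 + j).+1)) ?addrK //.
  by apply/funext => n; rewrite addnS.
(* Summation by parts: after substituting [f0] and [fS], the sums of b_k w^k with factors w and z
   combine, and only the boundary term z b_N w^N is left over. *)
have fP N : \sum_(0 <= k < N.+1) a k * w ^+ k = power_series a z +
    (w - z) * (\sum_(0 <= k < N) b k * w ^+ k) - z * b N * w ^+ N.
  elim: N => [|N IH].
    by rewrite big_nat1 big_geq // f0 mulr0 addr0 expr0 !mulr1 addrK.
  rewrite big_nat_recr //= IH [in RHS]big_nat_recr //= fS exprS; ring.
set q := power_series b w.
apply: (power_series_unique aM w1
  (B := normc (w - z) * (M' / (1 - normc w)) + normc z * M')) => N.
rewrite fP; set Q := \sum_(_ <= _ < _) _.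
have -> : power_series a z + (w - z) * q -
   (power_series a z + (w - z) * Q - z * b N * w ^+ N) =
   (w - z) * (q - Q) + z * b N * w ^+ N by ring.
apply: le_trans (normcD _ _) _; rewrite !normcM normcX mulrDl -!mulrA.
apply: lerD; rewrite ler_wpM2l ?normc_ge0 //.
  by rewrite mulrA; exact: (power_series_tail bM w1).
by rewrite ler_wpM2r ?exprn_ge0 ?normc_ge0.
Qed.

End increment.

Lemma power_series_continuous (R : realType) (a : nat -> R[i]) (M : R) (z : R[i]) :
  (forall n, normc (a n) <= M) -> normc z < 1 ->
  {for z, continuous (power_series a)}.
Proof.
move=> aM z1.
(* The midpoint of |z| and 1: for |w| < r the quotient series is bounded by M' / (1 - r),
   independently of w. *)
set r := (1 + normc z) / 2.
have r1 : r < 1 by rewrite /r; lra.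
have zr : 0 < r - normc z by rewrite /r; lra.
pose b := quotient_coef a z; pose M' := M / (1 - normc z).
have bM : forall k, normc (b k) <= M' by exact: quotient_coef_bound.
have M0 : 0 <= M' by exact: le_trans (normc_ge0 _) (bM 0%N).
(* Adding 1 keeps C positive even when M' = 0, so that e / C is a valid radius. *)
pose C := M' / (1 - r) + 1.
have C0 : 0 < C by rewrite ltr_wpDl // divr_ge0 // subr_ge0 ltW.
apply: (@cvg_normc _ _ (nbhs z)) => e e0; near=> w.
have hw : normc (w - z) < Num.min (r - normc z) (e / C).
  rewrite normc_sub; near: w; apply: near_normc.
  by rewrite lt_min zr divr_gt0.
move: hw; rewrite lt_min => /andP[hr he].
have wr : normc w < r.
  by rewrite -(subrK z w); apply: le_lt_trans (normcD _ _) _; rewrite -ltrBrDr.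
rewrite (power_series_increment aM z1 (w := w)) ?(lt_trans wr) //.
rewrite opprD addrA subrr sub0r normc_opp normcM.
apply: le_lt_trans (_ : normc (w - z) * C < e); last by rewrite -ltr_pdivlMr.
rewrite ler_wpM2l ?normc_ge0 //.
apply: le_trans (power_series_bound bM _) _; first exact: lt_trans wr r1.
rewrite /C; apply: le_trans (_ : M' / (1 - r) <= _); last by rewrite lerDl.
by rewrite ler_wpM2l // lef_pV2 ?posrE ?subr_gt0 // ?(lt_trans wr) // lerD2l lerN2 ltW.
Unshelve. all: by end_near. Qed.

Lemma power_series_derivable (R : realType) (a : nat -> R[i]) (M : R) (z : R[i]) :
  (forall n, normc (a n) <= M) -> normc z < 1 ->
  derivable (power_series a) z 1.
Proof.
move=> aM z1; pose b := quotient_coef a z.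
(* For h <> 0 with z + h in the disk, the difference quotient equals the quotient series at z + h;
   continuity of that series at z gives the limit. *)
apply/cvg_ex; exists (power_series b z).
have bM : forall k, normc (b k) <= M / (1 - normc z) by exact: quotient_coef_bound.
have bc := power_series_continuous bM z1.
have hz : (fun h : R[i] => h *: 1 + z) @ 0^' --> z.
  rewrite -[X in _ --> X]add0r -[X in X + z](scale0r (1 : R[i])).
  apply: cvgD; last exact: cvg_cst.
  by apply: cvgZr_tmp; exact: cvg_within.
have h1 := cvg_comp _ _ hz bc.
apply: cvg_trans h1; apply: near_eq_cvg; near=> h.
have h0 : h != 0 by near: h; exact: nbhs_dnbhs_neq.
rewrite /= (power_series_increment aM z1 (w := h *: 1 + z)).
  by rewrite addrAC subrr add0r addrK -[h *: 1]/(h * 1) mulr1 -[RHS]/(h^-1 * _) mulKf.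
by near: h; exact: hz _ (near_normc_lt1 z1).
Unshelve. all: by end_near. Qed.

(** * Generating functions *)

Section genfun.
Variable R : realType.
Implicit Types (S : set nat) (z : R[i]).

Lemma indic_le1 S n : normc (\1_S n : R[i]) <= 1.
Proof. by rewrite indicE; case: (_ \in _); rewrite ?normc1 ?normc0. Qed.

Lemma genfunE S z : normc z < 1 -> genfun R S z = power_series (\1_S) z.
Proof. by rewrite /genfun unit_diskE => ->. Qed.

Lemma genfun_tail S z N : normc z < 1 ->
  normc (genfun R S z - \sum_(0 <= k < N) \1_S k * z ^+ k)
    <= normc z ^+ N / (1 - normc z).
Proof.
move=> z1; rewrite genfunE // mulrC -[(1 - _)^-1]mul1r.
exact: (power_series_tail (indic_le1 S) z1).
Qed.

Lemma genfun_sub_le S S' z N : normc z < 1 ->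
  (forall n, (n < N)%N -> S n <-> S' n) ->
  normc (genfun R S z - genfun R S' z) <= 2 * (normc z ^+ N / (1 - normc z)).
Proof.
move=> z1 SS'; pose P U := \sum_(0 <= k < N) (\1_U k : R[i]) * z ^+ k.
have PP : P S = P S'.
  rewrite /P !big_mkord; apply: eq_bigr => i _; congr (_ * _).
  by rewrite !indicE; congr (_%:R); congr nat_of_bool; apply/idP/idP;
    rewrite !inE => /SS'; apply.
rewrite -(subrK (P S) (genfun R S z)) -addrA; apply: le_trans (normcD _ _) _.
rewrite mulr_natl mulr2n lerD ?genfun_tail // PP normc_sub; exact: genfun_tail.
Qed.

(** Needed because the compact set is defined as an image: from f_S in it, one must recover that S
    itself is Sidon. Coefficients are compared one at a time, by strong induction on the degree. *)
Lemma genfun_inj : injective (genfun R).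
Proof.
move=> S S' eqf; apply/funext => n; apply/propext.
elim/ltn_ind: n => n IH.
(* At 1/4 the two tails beyond degree n total at most 2/3 of 4^-n, too little to hide a difference
   of two coefficients in {0, 1} at degree n. *)
pose z : R[i] := (4^-1)%:C.
have nz : normc z = 4^-1 by rewrite normcR ger0_norm // invr_ge0.
have z1 : normc z < 1 by rewrite nz; lra.
pose P U N := \sum_(0 <= k < N) (\1_U k : R[i]) * z ^+ k.
have PP : P S n = P S' n.
  rewrite /P !big_mkord; apply: eq_bigr => i _; congr (_ * _).
  by rewrite !indicE; congr (_%:R); congr nat_of_bool; apply/idP/idP;
    rewrite !inE => /IH; apply.
have : normc (P S n.+1 - P S' n.+1) <= 2 * (normc z ^+ n.+1 / (1 - normc z)).
  rewrite -(subrK (genfun R S z) (P S n.+1)) -addrA; apply: le_trans (normcD _ _) _.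
  have h1 := genfun_tail S n.+1 z1; have h2 := genfun_tail S' n.+1 z1.
  by rewrite mulr_natl mulr2n lerD // ?eqf // normc_sub -?eqf.
rewrite /P !big_nat_recr //= -/(P S n) -/(P S' n) PP opprD addrACA subrr add0r.
rewrite -mulrBl normcM normcX nz exprS !indicE => hle.
have p0 : 0 < 4^-1 ^+ n :> R by rewrite exprn_gt0 // invr_gt0.
have key : normc ((n \in S)%:R - (n \in S')%:R : R[i]) < 1.
  rewrite -(ltr_pM2r p0) mul1r; apply: le_lt_trans hle _.
  by move: p0; set X := _ ^+ n => p0; rewrite (_ : 2 * _ = 2 / 3 * X); [lra | field].
split => h; apply: contrapT => h'; move: key.
  by rewrite (mem_set h) (memNset h') subr0 normc1 ltxx.
by rewrite (mem_set h) (memNset h') sub0r normc_opp normc1 ltxx.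
Qed.

Lemma genfun_hol S : hol_disk R (genfun R S).
Proof.
split => z; rewrite /unit_disk /= unit_diskE; last first.
  by move=> /negP /negbTE; rewrite /genfun unit_diskE => ->.
move=> z1; have := power_series_derivable (indic_le1 S) z1.
apply: near_eq_derivable; apply: filterS (near_normc_lt1 z1) => w w1.
by rewrite genfunE.
Qed.

Lemma continuous_normc : continuous (@normc R : R[i] -> R).
Proof.
move=> z; apply/(@cvgrPdist_lt _ _ _ (nbhs z)) => e e0; near=> w.
apply: le_lt_trans (_ : normc (z - w) < e); last by near: w; exact: near_normc.
have := normcD (z - w) w; have := normcD (w - z) z.
rewrite !subrK (normc_sub w z) ler_norml => h1 h2; lra.
Unshelve. all: by end_near. Qed.

(** On a nonempty compact set the modulus attains its maximum, at a point of the open disk; hence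
    the maximum is below 1. *)
Lemma compact_disk_bound (A : set R[i]) : compactly_in (unit_disk R) A ->
  exists2 r : R, 0 <= r < 1 & forall z, A z -> normc z <= r.
Proof.
move=> [Asub Ac]; have [->|/set0P A0] := eqVneq A set0.
  by exists 0; rewrite ?lexx ?ltr01.
have [c] := compact_EVT_max A0 Ac (continuous_subspaceT continuous_normc).
rewrite inE => /Asub; rewrite /unit_disk /= unit_diskE => c1 hc.
by exists (normc c); [rewrite normc_ge0 c1 | move=> z /mem_set; exact: hc].
Qed.

End genfun.

(** * Sidon sets in the Cantor space *)

Definition cantor_support (x : cantor_space) : set nat := [set n | x n].

(** Projections are continuous and [bool] is discrete, so each coordinate is locally constant;
    induction on N intersects finitely many such neighbourhoods. *)
Lemma near_cantor (x : cantor_space) N :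
  \forall y \near x, forall n, (n < N)%N -> y n = x n.
Proof.
elim: N => [|N IH]; first by near=> y => n; rewrite ltn0.
have hN : \forall y \near x, y N = x N.
  have hp : @proj nat (fun=> bool) N @ x --> x N := @proj_continuous nat (fun=> bool) N x.
  by apply: (hp [set x N]); apply/principal_filterP.
near=> y => n; rewrite ltnS leq_eqVlt => /predU1P[->|].
  by near: y.
by move: n; near: y.
Unshelve. all: by end_near. Qed.

Lemma genfun_continuous (R : realType) :
  continuous (genfun R \o cantor_support :
    cantor_space -> {family compactly_in (unit_disk R), R[i] -> R[i]}).
Proof.
move=> x; apply/fam_cvgP => A /compact_disk_bound[r /andP[r0 r1] Ar].
move=> U /uniform_nbhs[E [+ EU]]; rewrite -entourage_ballE => -[e e0 eE].
have [d d0 de] := gt0_complexE e0.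
(* N depends on r and d only, which makes the estimate uniform over the points of A. *)
have [N hN] : exists N, 2 * (r ^+ N / (1 - r)) < d.
  have r0' : 0 <= 2 / (1 - r) by rewrite divr_ge0 // subr_ge0 ltW.
  have r01 : 0 <= r < 1 by rewrite r0.
  have [N _ /(_ N (leqnn N)) hN] := near_geometric_lt r0' r01 d0.
  by exists N; rewrite [X in 2 * X]mulrC mulrA.
rewrite nbhs_simpl /=; apply: filterS (near_cantor x N) => y xy.
apply: EU => z Az /=; apply: eE; rewrite /= -ball_normE /= de norm_normc ltcR.
have zr := Ar _ Az; have z1 := le_lt_trans zr r1.
apply: le_lt_trans (genfun_sub_le (N := N) z1 _) _.
  by move=> n nN; rewrite /cantor_support /= xy.
apply: le_lt_trans hN; rewrite ler_wpM2l // ler_pM ?exprn_ge0 ?normc_ge0 //.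
- by rewrite invr_ge0 subr_ge0 ltW.
- by rewrite lerXn2r // nnegrE normc_ge0.
- by rewrite lef_pV2 ?posrE ?subr_gt0 // lerD2l lerN2.
Qed.

Lemma closed_sidon : closed [set x : cantor_space | sidon (cantor_support x)].
Proof.
move=> x hx; have hN N : exists2 y, sidon (cantor_support y) &
    forall n, (n < N)%N -> y n = x n.
  by have [y [y1 y2]] := hx _ (near_cantor x N); exists y.
split.
  move=> s; have [y [+ _] yx] := hN s.+1 => /(_ s).
  by rewrite /cantor_support /= yx.
move=> a b c d; have [y [_ +] yx] := hN (maxn (maxn a b) (maxn c d)).+1.
move=> /(_ a b c d); rewrite /cantor_support /= !yx //.
all: by rewrite ltnS !leq_max leqnn ?orbT.
Qed.

(** * Sidon sets on the interval [0, 1[ *)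

Section real_values.
Variable R : realType.
Implicit Types (S : set nat) (t : R).

Definition genfun_partial S N t : R := \sum_(0 <= k < N) \1_S k * t ^+ k.

(** Taking the real part loses nothing on [0, 1[, by [genfunR] below. *)
Definition genfun_real S t : R := complex.Re (genfun R S t%:C).

Lemma genfun_partialE S N t :
  \sum_(0 <= k < N) \1_S k * t%:C ^+ k = (genfun_partial S N t)%:C.
Proof.
rewrite /genfun_partial rmorph_sum; apply: eq_bigr => k _.
by rewrite rmorphM rmorphXn !indicE; case: (_ \in _).
Qed.

Lemma genfun_partial_ge0 S N t : 0 <= t -> 0 <= genfun_partial S N t.
Proof.
move=> t0; apply: sumr_ge0 => k _.
by rewrite mulr_ge0 ?exprn_ge0 // indicE; case: (_ \in _).
Qed.

Lemma normc_real_lt1 t : 0 <= t < 1 -> normc t%:C < 1.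
Proof. by move=> /andP[t0 t1]; rewrite normcR ger0_norm. Qed.

Lemma genfun_real_tail S N t : 0 <= t < 1 ->
  `|genfun_real S t - genfun_partial S N t| <= t ^+ N / (1 - t).
Proof.
move=> t01; have [t0 t1] := andP t01.
have := genfun_tail S N (normc_real_lt1 t01).
rewrite genfun_partialE normcR ger0_norm //; apply: le_trans.
by have := Re_le_normc (genfun R S t%:C - (genfun_partial S N t)%:C); rewrite raddfB.
Qed.

(** Partial sums at a real point are real, so the real part of the sum obeys the same tail estimate
    as the sum and equals it by [power_series_unique]. *)
Lemma genfunR S t : 0 <= t < 1 -> genfun R S t%:C = (genfun_real S t)%:C.
Proof.
move=> t01; have [t0 t1] := andP t01; have z1 := normc_real_lt1 t01.
rewrite genfunE //.
apply: (power_series_unique (indic_le1 R S) z1 (B := (1 - t)^-1)) => N.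
rewrite genfun_partialE -rmorphB !normcR (ger0_norm t0) [leRHS]mulrC.
apply: le_trans (genfun_real_tail _ _ t01) _.
by rewrite ler_wpM2r ?invr_ge0 ?subr_ge0 ?(ltW t1) // exprS ler_piMl ?exprn_ge0 ?(ltW t1).
Qed.

Lemma genfun_partial_cvg S t : 0 <= t < 1 ->
  genfun_partial S N t @[N --> \oo] --> genfun_real S t.
Proof.
move=> t01; have [t0 t1] := andP t01; apply/cvgrPdist_lt => e e0.
have c0 : 0 <= (1 - t)^-1 by rewrite invr_ge0 subr_ge0 ltW.
apply: filterS (near_geometric_lt c0 t01 e0) => N.
by rewrite [ltLHS]mulrC; apply: le_lt_trans; exact: genfun_real_tail.
Qed.

Lemma genfun_real_sub_le S S' N t : 0 <= t < 1 ->
  (forall n, (n < N)%N -> S n <-> S' n) ->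
  `|genfun_real S t - genfun_real S' t| <= 2 * (t ^+ N / (1 - t)).
Proof.
move=> t01 SS'; have [t0 _] := andP t01.
have := genfun_sub_le (normc_real_lt1 t01) SS'; rewrite (normcR t) ger0_norm //.
rewrite !genfunR // -rmorphB normcR; exact.
Qed.

(* Squaring a partial sum gives \sum_m r_m t^m, where r_m <= 2 counts the ordered
   pairs of elements of S with sum m. *)
Lemma sidon_partial_sqr_le S N t : sidon S -> 0 <= t < 1 ->
  genfun_partial S N t ^+ 2 <= 2 * (t / (1 - t)).
Proof.
move=> [Spos Ssid] t01; have [t0 t1] := andP t01.
pose A : pred ('I_N * 'I_N) := fun p => ((p.1 : nat) \in S) && ((p.2 : nat) \in S).
have -> : genfun_partial S N t ^+ 2 = \sum_(p | A p) t ^+ (p.1 + p.2).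
  have E : genfun_partial S N t = \sum_(i < N | (i : nat) \in S) t ^+ i.
    rewrite /genfun_partial big_mkord [RHS]big_mkcond /=; apply: eq_bigr => i _.
    by rewrite indicE; case: ifP => _; rewrite ?mul1r ?mul0r.
  rewrite expr2 E big_distrlr /= pair_big_dep /=; apply: eq_big => // p _.
  by rewrite exprD.
pose F m := [pred p : 'I_N * 'I_N | A p && (p.1 + p.2 == m)%N].
(* One pair (a, b) with sum m determines the others up to a swap. The four cases below sort both
   pairs, since the Sidon property speaks of ordered summands. *)
have Fcard m : (#|F m| <= 2)%N.
  have [/eqP ->//|/pred0Pn[[a b]]] := boolP (#|F m| == 0)%N.
  rewrite !inE /A /= => /andP[/andP[aS bS] /eqP abm].
  apply: (@leq_trans #|pred2 (a, b) (b, a)|); last by rewrite card2; case: (_ != _).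
  apply: subset_leq_card; apply/fintype.subsetP => -[c d].
  rewrite !inE /A /= => /andP[/andP[cS dS] /eqP cdm].
  move: aS bS cS dS; rewrite !inE => aS bS cS dS.
  have sid (x y u v : 'I_N) : S x -> S y -> S u -> S v -> (x <= y)%N -> (u <= v)%N ->
      (x + y = u + v)%N -> x = u /\ y = v.
    by move=> *; have [] := Ssid x y u v; do ?[move=> /val_inj ->].
  rewrite !xpair_eqE.
  have [cd|/ltnW dc] := leqP c d; have [ab|/ltnW ba] := leqP a b.
  - by have [-> ->] := sid _ _ _ _ cS dS aS bS cd ab (etrans cdm (esym abm)); rewrite !eqxx.
  - have [|-> ->] := sid _ _ _ _ cS dS bS aS cd ba; last by rewrite !eqxx orbT.
    by rewrite cdm -abm addnC.
  - have [|-> ->] := sid _ _ _ _ dS cS aS bS dc ab; last by rewrite !eqxx orbT.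
    by rewrite abm -cdm addnC.
  - have [|-> ->] := sid _ _ _ _ dS cS bS aS dc ba; last by rewrite !eqxx.
    by rewrite addnC cdm -abm addnC.
(* Pairs are grouped by their sum, which stays below N + N. *)
have -> : \sum_(p | A p) t ^+ (p.1 + p.2) = \sum_(m < N + N) (#|F m|)%:R * t ^+ m.
  have hlt (p : 'I_N * 'I_N) : (p.1 + p.2 < N + N)%N.
    by rewrite -addSn leq_add // ltnW.
  rewrite (partition_big (fun p => Ordinal (hlt p)) xpredT) //=.
  apply: eq_bigr => m _; rewrite -sum1_card natr_sum mulr_suml.
  apply: eq_big => p; first by rewrite inE -val_eqE.
  by move=> /andP[_ /eqP <-]; rewrite mul1r.
(* Positivity of the elements of S removes the constant term; the geometric sum then starts at m = 1
   and supplies the factor t in the bound. *)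
have F0 : #|F 0%N| = 0%N.
  apply: eq_card0 => p; rewrite !inE /A; apply/negP => /andP[/andP[]].
  by rewrite inE => /Spos; case: (p.1) => -[].
apply: (@le_trans _ _ (\sum_(1 <= m < N + N) 2 * t ^+ m)).
  rewrite -(big_mkord xpredT (fun m => #|F m|%:R * t ^+ m)).
  case: (N + N)%N => [|M]; first by rewrite !big_geq.
  rewrite big_ltn // F0 mul0r add0r; apply: ler_sum => m _.
  by rewrite ler_wpM2r ?exprn_ge0 // ler_nat.
by rewrite -big_distrr ler_wpM2l // -[leRHS]/(t ^+ 1 / _) sum_geometric_le.
Qed.

Lemma sidon_genfun_le S t : sidon S -> 0 <= t < 1 ->
  `|genfun_real S t| <= 2 * (Num.sqrt t / Num.sqrt (1 - t)).
Proof.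
move=> sS t01; have [t0 t1] := andP t01.
set w := _ / _; have w0 : 0 <= w by rewrite divr_ge0 ?sqrtr_ge0.
(* The squared bound would give the constant sqrt 2; it is relaxed to 2 through 2 w^2 <= (2 w)^2. *)
have Pw N : genfun_partial S N t <= 2 * w.
  rewrite -ler_sqr ?nnegrE ?mulr_ge0 ?genfun_partial_ge0 //.
  apply: le_trans (sidon_partial_sqr_le N sS t01) _.
  rewrite exprMn /w expr_div_n !sqr_sqrtr ?subr_ge0 ?(ltW t1) //.
  rewrite expr2 -mulrA ler_wpM2l // ler_peMl ?divr_ge0 ?subr_ge0 ?(ltW t1) //.
  by rewrite ler1n.
have c := genfun_partial_cvg (S := S) t01.
rewrite ler_norml; apply/andP; split.
  apply: le_trans (_ : 0 <= _); first by rewrite oppr_le0 mulr_ge0.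
  by rewrite -(cvg_lim _ c) //; apply: limr_ge; [apply/cvg_ex; eexists; exact: c|
    apply: nearW => N; exact: genfun_partial_ge0].
by rewrite -(cvg_lim _ c) //; apply: limr_le; [apply/cvg_ex; eexists; exact: c|
    exact: nearW].
Qed.

Lemma genfun_real_measurable S : measurable_fun (`[0, 1[ : set R) (genfun_real S).
Proof.
apply: (@measurable_fun_cvg _ _ _ _ (fun N t => genfun_partial S N t)).
  move=> N; apply: measurable_sum => k.
  by apply: measurable_funM => //; exact: measurable_funX.
by move=> t; rewrite /= in_itv /=; exact: genfun_partial_cvg.
Qed.

End real_values.

(** * Integrals against |f| and their uniform continuity on Sidon sets *)

Section weighted_integral.
Variables (R : realType) (f : R -> R[i]).
Let D : set R := `[0, 1[.
Let mu := @lebesgue_measure R.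
Hypothesis cf : {within `[0, 1[, continuous f}.
Hypothesis fint : (\int[mu]_(t in D)
  (normc (f t) * Num.sqrt t / Num.sqrt (1 - t))%:E < +oo)%E.

Let weight (t : R) : R := Num.sqrt t / Num.sqrt (1 - t).
Let phi (t : R) : R := normc (f t).

Let mD : measurable D. Proof. exact: measurable_itv. Qed.

Let inD t : D t -> 0 <= t < 1. Proof. by rewrite /D /= in_itv. Qed.

Let measurable_in (g : R -> R) : {in D, continuous g} -> measurable_fun D g.
Proof.
by move=> cg; apply: subspace_continuous_measurable_fun => //; exact: continuous_in_subspaceT.
Qed.

Let measurable_phi : measurable_fun D phi.
Proof.
apply: subspace_continuous_measurable_fun => // x.
by apply: continuous_comp; [exact: cf | exact: continuous_normc].
Qed.

Let measurable_weight : measurable_fun D weight.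
Proof.
apply: measurable_in => t; rewrite inE => /inD /andP[t0 t1].
apply: cvgM; first exact: sqrt_continuous.
apply: cvgV; first by rewrite gt_eqF // sqrtr_gt0 subr_gt0.
apply: (@cvg_comp _ _ _ (fun x : R => 1 - x) (@Num.sqrt R) _
  (nbhs (1 - t))); last exact: sqrt_continuous.
by apply: cvgB; [exact: cvg_cst | exact: cvg_id].
Qed.

Let measurable_tail N : measurable_fun D (fun t : R => 2 * (t ^+ N / (1 - t))).
Proof.
apply: measurable_in => t; rewrite inE => /inD /andP[t0 t1].
apply: cvgM; first exact: cvg_cst.
apply: cvgM; first exact: exprn_continuous.
apply: cvgV; first by rewrite gt_eqF // subr_gt0.
by apply: cvgB; [exact: cvg_cst | exact: cvg_id].
Qed.

Let weight_ge0 t : 0 <= weight t.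
Proof. by rewrite divr_ge0 ?sqrtr_ge0. Qed.

Let phi_ge0 t : 0 <= phi t. Proof. exact: normc_ge0. Qed.

Let integrable_weight c : mu.-integrable D (EFin \o (fun t => phi t * (c * weight t))).
Proof.
have -> : EFin \o (fun t => phi t * (c * weight t)) =
    (fun t => c%:E * (phi t * weight t)%:E)%E.
  by apply/funext => t /=; rewrite -EFinM mulrCA.
apply: integrableZl => //; apply/integrableP; split.
  by apply/measurable_EFinP; exact: measurable_funM.
move: fint; congr (_ < +oo)%E; apply: eq_integral => t _.
by rewrite /= ger0_norm ?mulr_ge0 // mulrA.
Qed.

Let h S (t : R) := genfun_real S t * normc (f t).

Lemma sidon_integrable S : sidon S -> mu.-integrable D (EFin \o h S).
Proof.
move=> sS; apply: le_integrable (integrable_weight 2) => //.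
  apply/measurable_EFinP; apply: measurable_funM => //.
  exact: genfun_real_measurable.
move=> t /inD t01; rewrite /= lee_fin normrM mulrC.
rewrite [leRHS]ger0_norm ?mulr_ge0 // ger0_norm ?normc_ge0 // ler_wpM2l ?normc_ge0 //.
exact: sidon_genfun_le.
Qed.

(** Bounds |f| |f_S - f_S'| for all Sidon sets S, S' that agree below N. The first entry of the
    minimum adds two Sidon bounds 2 [weight] and provides an integrable dominating function; the
    second comes from the agreement below N and tends to 0 pointwise. *)
Let majorant N (t : R) := phi t * Num.min (4 * weight t) (2 * (t ^+ N / (1 - t))).

Let majorant_ge0 N t : D t -> 0 <= majorant N t.
Proof.
move=> /inD /andP[t0 t1]; rewrite mulr_ge0 // le_min !mulr_ge0 //.
  by rewrite exprn_ge0.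
by rewrite invr_ge0 subr_ge0 ltW.
Qed.

Let majorant_le N t : majorant N t <= phi t * (4 * weight t).
Proof. by rewrite ler_wpM2l // ge_min lexx. Qed.

Let measurable_majorant N : measurable_fun D (majorant N).
Proof.
apply: measurable_funM => //; apply: measurable_minr => //.
by apply: measurable_funM.
Qed.

Let integrable_majorant N : mu.-integrable D (EFin \o majorant N).
Proof.
apply: le_integrable (integrable_weight 4) => //.
  by apply/measurable_EFinP; exact: measurable_majorant.
move=> t Dt /=; rewrite lee_fin ger0_norm ?majorant_ge0 // ger0_norm ?mulr_ge0 //.
Qed.

Let majorant_cvg0 t : D t -> majorant N t @[N --> \oo] --> (0 : R).
Proof.
move=> Dt; have /andP[t0 t1] := inD Dt; apply/cvgrPdist_lt => e e0.
have c0 : 0 <= phi t * 2 / (1 - t) by rewrite !mulr_ge0 // invr_ge0 subr_ge0 ltW.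
apply: filterS (near_geometric_lt c0 (inD Dt) e0) => N; apply: le_lt_trans.
rewrite sub0r normrN ger0_norm ?majorant_ge0 //.
rewrite (_ : _ / _ * _ = phi t * (2 * (t ^+ N / (1 - t)))); last by ring.
by rewrite ler_wpM2l // ge_min lexx orbT.
Qed.

Let integral_majorant_cvg0 : \int[mu]_(t in D) majorant N t @[N --> \oo] --> (0 : R).
Proof.
have [|||||_ _] := @dominated_convergence _ _ _ mu D mD
    (fun N => EFin \o majorant N) (cst 0%E) (EFin \o (fun t => phi t * (4 * weight t))).
- by move=> N; apply/measurable_EFinP; exact: measurable_majorant.
- exact: measurable_cst.
- apply: aeW => t Dt; apply/fine_cvgP; split; first exact: nearW.
  exact: majorant_cvg0.
- exact: integrable_weight.
- apply: aeW => t N Dt; rewrite /= lee_fin ger0_norm ?majorant_ge0 //.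
rewrite integral0 => /fine_cvgP[_].
exact.
Qed.

(** The integral of [majorant N] controls the difference and does not involve S or S', so one N
    serves all pairs. *)
Lemma sidon_integral_continuous e : 0 < e -> exists N, forall S S',
  sidon S -> sidon S' -> (forall n, (n < N)%N -> S n <-> S' n) ->
  `|\int[mu]_(t in D) h S t - \int[mu]_(t in D) h S' t| < e.
Proof.
move=> e0; have /cvgrPdist_lt /(_ _ e0) [N _ /(_ N (leqnn N)) hN] := integral_majorant_cvg0.
exists N => S S' sS sS' SS'.
have iS := sidon_integrable sS; have iS' := sidon_integrable sS'.
rewrite -RintegralB //.
apply: le_lt_trans (_ : \int[mu]_(t in D) majorant N t < e); last first.
  by apply: le_lt_trans hN; rewrite sub0r normrN ler_norm.
have iB : mu.-integrable D (EFin \o (fun t => h S t - h S' t)).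
  exact: (@integrableB _ _ _ mu _ mD _ _ iS iS').
apply: le_trans (le_normr_Rintegral _ _) _ => //.
apply: le_Rintegral => //.
  exact: integrable_norm iB.
move=> t /inD t01; rewrite /h -mulrBl normrM mulrC [`|normc _|]ger0_norm ?normc_ge0 //.
rewrite ler_wpM2l ?normc_ge0 // le_min genfun_real_sub_le // andbT.
apply: le_trans (ler_normB _ _) _.
have := sidon_genfun_le sS t01; have := sidon_genfun_le sS' t01.
rewrite -/(weight t) => h1 h2; lra.
Qed.

End weighted_integral.

(** * The compact family and the extremal problem *)

Theorem theorem1p1 (R : realType) :
  exists frakS : set {family compactly_in (unit_disk R), R[i] -> R[i]},
    [/\ frakS `<=` hol_disk R,
        compact frakS,
        (forall S : set nat,
           sidon S /\ S `<=` [set n | (0 < n)%N] <-> frakS (genfun R S)),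
        (forall (g : R[i] -> R[i]) (t : R),
           frakS g -> 0 <= t < 1 -> complex.Im (g t%:C) = 0)
      & (forall f : R -> R[i],
           {within `[0, 1[, continuous f} ->
           (\int[lebesgue_measure]_(t in `[0%R, 1%R[)
              (normc (f t) * Num.sqrt t / Num.sqrt (1 - t))%:E < +oo)%E ->
           let h (g : R[i] -> R[i]) (t : R) :=
             complex.Re (g t%:C) * normc (f t) in
           let J (g : R[i] -> R[i]) :=
             \int[lebesgue_measure]_(t in `[0, 1[) h g t in
           [/\ (forall g, frakS g ->
                  lebesgue_measure.-integrable `[0%R, 1%R[ (EFin \o h g)),
               has_ubound [set J g | g in frakS]
             & exists2 g0, frakS g0 & J g0 = sup [set J g | g in frakS]])].
Proof.
pose K := [set x : cantor_space | sidon (cantor_support x)].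
have cK : compact K by exact: subclosed_compact closed_sidon cantor_space_compact _.
(* The empty set is Sidon; the extreme value theorem below requires a nonempty set. *)
have K0 : K !=set0 by exists (fun=> false); split.
exists ((genfun R \o cantor_support) @` K); split.
- by move=> _ [x _ <-]; exact: genfun_hol.
- by apply: continuous_compact cK; apply: continuous_subspaceT; exact: genfun_continuous.
- move=> S; split=> [[sS _]|[x sx /genfun_inj <-]]; last by split => //; case: sx.
  have xS : cantor_support (fun n => `[< S n >]) = S.
    by apply/funext => n; rewrite /cantor_support /= asboolE.
  by exists (fun n => `[< S n >]); rewrite /K /= xS.
- by move=> _ t [x _ <-] t01; rewrite /= genfunR.
move=> f cf fint h J.
(* The maximum is sought on K in the Cantor space rather than on its image, so only agreement of
   sets on an initial segment is used. Continuity is relative to K because the integral estimate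
   compares Sidon sets. *)
have cJ : {within K, continuous (J \o genfun R \o cantor_support)}.
  apply/subspace_continuousP => x Kx; apply/cvgrPdist_lt => e e0.
  have [N hN] := sidon_integral_continuous cf fint e0.
  rewrite near_withinE; near=> y => Ky.
  apply: hN => // n nN; rewrite /cantor_support /=.
  suff -> : y n = x n by [].
  by move: n nN; near: y; exact: near_cantor.
have [x /set_mem Kx xmax] := compact_EVT_max K0 cK cJ.
have ub : ubound [set J g | g in (genfun R \o cantor_support) @` K]
    (J (genfun R (cantor_support x))).
  by move=> _ [_ [y Ky <-] <-]; apply: xmax; exact: mem_set.
split.
- by move=> _ [y Ky <-]; exact: sidon_integrable.
- by eexists; exact: ub.
exists (genfun R (cantor_support x)); first by exists x.
apply/le_anti; rewrite ub_le_sup /=; last 2 first.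
- by eexists; exact: ub.
- by exists (genfun R (cantor_support x)) => //; exists x.
apply: ge_sup => //.
by exists (J (genfun R (cantor_support x))), (genfun R (cantor_support x)) => //; exists x.
Unshelve. all: by end_near. Qed.
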